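(* Let $E$ be a finite set, $S=\mathbb{C}[x_e:e\in E]$, and let $I\subset S$ be a standard-homogeneous ideal that contains no monomial. Let $w\in\mathbb{R}^E$ be such that $\operatorname{in}_wI$ contains no monomial, and let $\Theta=\operatorname{subd}_w\mathcal A(I)$. Let $\operatorname{in}_wX^\circ=\operatorname{Spec}$ of the degree-$0$ part of $S^\circ/(\operatorname{in}_wI)S^\circ$. For each cell $\Delta$ of $\Theta$, let $X^\circ_\Delta=\operatorname{Spec}R^\circ_\Delta$, where $R^\circ_\Delta$ is the degree-$0$ part of $\mathbb{C}[\Delta]^\circ/I_\Delta\mathbb{C}[\Delta]^\circ$ and $I_\Delta=\rho_\Delta(I)$. For cells $\Delta\subset\Gamma$, let $X^\circ_\Gamma\to X^\circ_\Delta$ be the morphism induced by the inclusion $\mathbb{C}[\Delta]^\circ\subset\mathbb{C}[\Gamma]^\circ$. This gives a diagram of affine schemes of shape $\mathbf J(\Theta)^{\mathrm{op}}$. Then the inclusions $\mathbb{C}[\Delta]^\circ\subset S^\circ$ (i.e. the coordinate projections $(\mathbb{C}^\times)^E/\mathbb{C}^\times\to(\mathbb{C}^\times)^\Delta/\mathbb{C}^\times$) induce morphisms $\operatorname{in}_wX^\circ\to X^\circ_\Delta$, and hence a mediating morphism $$\operatorname{in}_wX^\circ\to\varprojlim_{\mathbf J(\Theta)^{\mathrm{op}}}X^\circ_\Delta$$ to the limit in the category of affine schemes. If every $a_e$, $e\in E$, lies in some cell of $\Theta$, this morphism is a closed immersion.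
   Context: $\operatorname{in}_w p$ is the sum of the terms of $p$ of minimal $w$-weight, and $\operatorname{in}_wI$ is the ideal they generate. $\mathcal L(I)=\{w:\operatorname{in}_wI=I\}$. $\mathcal A(I)=(a_e)_{e\in E}\subset\mathcal L(I)^*$, where $a_e$ is the restriction of the $e$-th coordinate functional to $\mathcal L(I)$. $\operatorname{subd}_wA$, for a point configuration $A=(a_e)$ in $V$, is the set of cells $(a_e)_{e\in E_f}$, for $f\in V^*$, where $E_f$ is the set of $e$ minimizing $f(a_e)+w_e$. We write $a_e\in\Delta$ if $e$ is a label of $\Delta$. $\mathbf J(\Theta)$ is the poset category of cells under inclusion. $S^\circ=\mathbb{C}[x_e^{\pm1}:e\in E]$ and $\mathbb{C}[\Delta]^\circ=\mathbb{C}[x_e^{\pm1}:a_e\in\Delta]$. $\rho_\Delta:S\to\mathbb{C}[\Delta]=\mathbb{C}[x_e:a_e\in\Delta]$ kills the other variables. ''Degree-$0$ part'' refers to the standard $\mathbb{Z}$-grading (the $\mathbb{C}^\times$-invariants under scaling all variables). *)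

(* Defs.v *)
From HB Require Import structures.
From mathcomp Require Import all_boot all_order all_algebra.
From mathcomp Require Import finmap.
From mathcomp Require Import boolp classical_sets reals.
From mathcomp Require Import complex monalg.

Set Implicit Arguments.
Unset Strict Implicit.
Unset Printing Implicit Defensive.

Import Order.TTheory GRing.Theory Num.Theory.
Local Open Scope classical_set_scope.
Local Open Scope ring_scope.
Local Open Scope quotient_scope.

Section Ideals.
Variable A : comPzRingType.
Implicit Types (J X : set A).

Definition is_ideal J : Prop :=
  [/\ J 0, forall a b, J a -> J b -> J (a + b) & forall a b, J b -> J (a * b)].

Definition ideal_gen X : set A :=
  [set a | forall J, is_ideal J -> X `<=` J -> J a].

Lemma ideal_gen_ideal X : is_ideal (ideal_gen X).
Proof.
split=> [J []//|a b Xa Xb J HJ XJ|a b Xb J HJ XJ]; case: (HJ) => _ JD JM.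
  by apply: JD; [exact: Xa|exact: Xb].
by apply: JM; exact: Xb.
Qed.

Lemma sub_ideal_gen X : X `<=` ideal_gen X.
Proof. by move=> a Xa J _; apply. Qed.

Lemma idealN J a : is_ideal J -> J a -> J (- a).
Proof. by case=> _ _ JM Ja; rewrite -mulN1r; apply: JM. Qed.

Lemma idealB J a b : is_ideal J -> J a -> J b -> J (a - b).
Proof. by move=> HJ Ja Jb; case: (HJ) => _ JD _; apply: JD => //; apply: idealN. Qed.

Definition is_prime_ideal J : Prop :=
  [/\ is_ideal J, ~ J 1 & forall a b, J (a * b) -> J a \/ J b].

End Ideals.

Section Quotient.
Variables (A : comPzRingType) (X : set A).
Local Notation J := (ideal_gen X).
Let HJ : is_ideal J := ideal_gen_ideal X.

Definition quot_rel (a b : A) : bool := `[< ideal_gen X (a - b) >].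

Lemma quot_rel_equiv : equiv_class_of quot_rel.
Proof.
split=> [a|a b|b a c].
- by apply/asboolP; rewrite subrr; case: HJ.
- by apply/asboolP/asboolP => /(idealN HJ); rewrite opprB.
- move=> /asboolP ab /asboolP bc; apply/asboolP.
  by rewrite -(subrK b a) -addrA; case: HJ => _ + _; apply.
Qed.

Canonical quot_rel_equivRel := EquivRelPack quot_rel_equiv.
Canonical quot_rel_encModRel := defaultEncModRel quot_rel.

(** The quotient is taken by the ideal generated by [X], and may be zero. *)
Definition quotient := {eq_quot quot_rel}.
HB.instance Definition _ : EqQuotient A quot_rel quotient :=
  EqQuotient.on quotient.
HB.instance Definition _ := Choice.on quotient.

Definition qproj (a : A) : quotient := \pi_quotient a.

Lemma qprojP a b : qproj a = qproj b <-> ideal_gen X (a - b).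
Proof.
split=> [/eqP|H]; last apply/eqP; rewrite /qproj piE; last exact/asboolP.
by move/asboolP.
Qed.

Lemma qprojK (q : quotient) : qproj (repr q) = q.
Proof. exact: reprK. Qed.

Let qzero : quotient := qproj 0.
Let qone : quotient := qproj 1.
Let qopp (q : quotient) : quotient := qproj (- repr q).
Let qadd (q r : quotient) : quotient := qproj (repr q + repr r).
Let qmul (q r : quotient) : quotient := qproj (repr q * repr r).

Let qoppE a : qopp (qproj a) = qproj (- a).
Proof.
apply/qprojP; rewrite -opprD; apply: (idealN HJ); apply/qprojP.
by rewrite qprojK.
Qed.

Let qaddE a b : qadd (qproj a) (qproj b) = qproj (a + b).
Proof.
apply/qprojP; rewrite opprD addrACA.
by case: HJ => _ + _; apply; apply/qprojP; rewrite qprojK.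
Qed.

Let qmulE a b : qmul (qproj a) (qproj b) = qproj (a * b).
Proof.
apply/qprojP; set a' := repr _; set b' := repr _.
rewrite -(subrK (a * b') (a' * b')) -addrA -mulrBl -mulrBr.
case: HJ => _ JD JM; apply: JD; rewrite ?[_ * b']mulrC; apply: JM; apply/qprojP;
by rewrite qprojK.
Qed.

Let qaddA : associative qadd.
Proof.
by move=> x y z; rewrite -[x]qprojK -[y]qprojK -[z]qprojK !qaddE addrA.
Qed.
Let qaddC : commutative qadd.
Proof. by move=> x y; rewrite -[x]qprojK -[y]qprojK !qaddE addrC. Qed.
Let qadd0 : left_id qzero qadd.
Proof. by move=> x; rewrite -[x]qprojK qaddE add0r. Qed.
Let qaddN : left_inverse qzero qopp qadd.
Proof. by move=> x; rewrite -[x]qprojK qoppE qaddE addNr. Qed.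

HB.instance Definition _ :=
  GRing.isZmodule.Build quotient qaddA qaddC qadd0 qaddN.

Let qmulA : associative qmul.
Proof.
by move=> x y z; rewrite -[x]qprojK -[y]qprojK -[z]qprojK !qmulE mulrA.
Qed.
Let qmulC : commutative qmul.
Proof. by move=> x y; rewrite -[x]qprojK -[y]qprojK !qmulE mulrC. Qed.
Let qmul1 : left_id qone qmul.
Proof. by move=> x; rewrite -[x]qprojK qmulE mul1r. Qed.
Let qmulD : left_distributive qmul +%R.
Proof.
move=> x y z; rewrite -[x]qprojK -[y]qprojK -[z]qprojK.
by rewrite [_ + _]qaddE !qmulE [RHS]qaddE mulrDl.
Qed.

HB.instance Definition _ :=
  GRing.Zmodule_isComPzRing.Build quotient qmulA qmulC qmul1 qmulD.

Lemma qproj0 : qproj 0 = 0. Proof. by []. Qed.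
Lemma qproj1 : qproj 1 = 1. Proof. by []. Qed.
Lemma qprojN a : qproj (- a) = - qproj a. Proof. by rewrite -qoppE. Qed.
Lemma qprojD a b : qproj (a + b) = qproj a + qproj b.
Proof. by rewrite -qaddE. Qed.
Lemma qprojM a b : qproj (a * b) = qproj a * qproj b.
Proof. by rewrite -qmulE. Qed.

End Quotient.

(** The category of affine schemes, as the opposite of the category of
    commutative rings: the scheme [Spec A] is recorded by its coordinate ring,
    and a morphism by its comorphism.  The underlying space and the stalks of
    the structure sheaf are recovered below. *)
Record affineScheme := Spec { coordRing : comPzRingType }.

Definition amor (X Y : affineScheme) :=
  {rmorphism coordRing Y -> coordRing X}.

Notation "X ~> Y" := (amor X Y) (at level 90, right associativity).

Section Points.

Definition points (X : affineScheme) :=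
  {P : set (coordRing X) | is_prime_ideal P}.

Definition zariski_closed (X : affineScheme) (Z : set (points X)) : Prop :=
  exists F : set (coordRing X), Z = [set x | F `<=` sval x].

Lemma preim_prime (X Y : affineScheme) (u : X ~> Y)
    (P : set (coordRing X)) : is_prime_ideal P -> is_prime_ideal (u @^-1` P).
Proof.
case=> -[P0 PD PM] P1 Pprime; split=> [|/=|a b /=].
- split=> [|a b|a b] /=; rewrite ?rmorph0 ?rmorphD ?rmorphM //.
    exact: PD.
  exact: PM.
- by rewrite rmorph1.
- by rewrite rmorphM; apply: Pprime.
Qed.

Definition on_points (X Y : affineScheme) (u : X ~> Y) (x : points X) :
    points Y :=
  exist _ (u @^-1` sval x) (preim_prime u (svalP x)).

(** [a / s = b / t] in the local ring of [X] at [x], where [s] and [t] do not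
    vanish at [x]. *)
Definition stalk_eq (X : affineScheme) (x : points X)
    (a s b t : coordRing X) : Prop :=
  exists2 r, ~ sval x r & r * (a * t - b * s) = 0.

(** Surjectivity of the map from the local ring of [Y] at the image of [x] to
    the local ring of [X] at [x]. *)
Definition stalk_surjective (X Y : affineScheme) (u : X ~> Y) (x : points X) :
    Prop :=
  forall a s, ~ sval x s ->
  exists b t, ~ sval (on_points u x) t /\ stalk_eq x (u b) (u t) a s.

(** A homeomorphism onto a closed subset which is surjective on structure
    sheaves.  The image being closed, the stalks of the pushed-forward sheaf at
    points off the image vanish, so that the latter condition only concerns
    the points of [X]. *)
Definition closed_immersion (X Y : affineScheme) (u : X ~> Y) : Prop :=
  [/\ injective (on_points u),
      forall Z : set (points X), zariski_closed Z <->
        exists2 W, zariski_closed W & Z = on_points u @^-1` W,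
      zariski_closed (range (on_points u))
    & forall x, stalk_surjective u x].

End Points.

(** Diagrams of shape [J^op], for a poset [J] given by [le]. *)
Section Limits.
Variables (J : Type) (le : J -> J -> Prop) (D : J -> affineScheme).
Implicit Type t : forall i j, le i j -> (D j ~> D i).

Definition is_diagram t : Prop :=
  (forall i (h : le i i), t i i h =1 id) /\
  (forall i j k (hij : le i j) (hjk : le j k) (hik : le i k),
     t i k hik =1 t j k hjk \o t i j hij).

Definition is_cone t (X : affineScheme) (p : forall i, X ~> D i) : Prop :=
  forall i j (h : le i j), p j \o t i j h =1 p i.

Definition is_mediating (L : affineScheme) (q : forall i, L ~> D i)
    (X : affineScheme) (p : forall i, X ~> D i) (u : X ~> L) : Prop :=
  forall i, u \o q i =1 p i.

Definition is_limit t (L : affineScheme) (q : forall i, L ~> D i) : Prop :=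
  is_cone t q /\
  forall X (p : forall i, X ~> D i), is_cone t p ->
    exists2 u, is_mediating q p u &
      forall u', is_mediating q p u' -> u' =1 u.

End Limits.

Notation polyring K F := {malg K[{cmonom F}]}.

Section Laurent.
Variables (K : comNzRingType) (F : finType).

(** The ring [K[x_e^{+-1} : e in F]]: the group algebra of [Z^F]. *)
Definition laurent := {malg K[{ffun F -> int}]}.
HB.instance Definition _ := GRing.Lmodule.on laurent.

Implicit Types p q : laurent.

Definition lmul p q : laurent :=
  \sum_(a <- msupp p) \sum_(b <- msupp q) << p@_a * q@_b *g a + b >>.

Definition lone : laurent := << 0 >>.

Lemma lmulw (d1 d2 : {fset {ffun F -> int}}) p q :
  (msupp p `<=` d1)%fset -> (msupp q `<=` d2)%fset ->
  lmul p q = \sum_(a <- d1) \sum_(b <- d2) << p@_a * q@_b *g a + b >>.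
Proof.
move=> le_d1 le_d2; rewrite /lmul (big_fset_incl _ le_d1) /=.
  apply/eq_bigr=> a _; apply/big_fset_incl => // k _ /mcoeff_outdom ->.
  by rewrite mulr0 monalgU0.
move=> k _ /mcoeff_outdom pk.
by rewrite big1 => // k' _; rewrite pk mul0r monalgU0.
Qed.

Lemma lmulC : commutative lmul.
Proof.
move=> p q; rewrite /lmul exchange_big; apply: eq_bigr => a _.
by apply: eq_bigr => b _; rewrite mulrC addrC.
Qed.

Lemma lmulDl : left_distributive lmul +%R.
Proof.
move=> p q r; rewrite (lmulw (msuppD_le _ _) (fsubset_refl _)).
rewrite (lmulw (fsubsetUl _ (msupp q)) (fsubset_refl _)).
rewrite (lmulw (fsubsetUr (msupp p) _) (fsubset_refl _)).
rewrite -big_split; apply: eq_bigr => a _.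
rewrite -big_split; apply: eq_bigr => b _.
by rewrite mcoeffD mulrDl monalgUD.
Qed.

Lemma lmul0 : left_zero 0 lmul.
Proof. by move=> p; rewrite /lmul msupp0 big_seq_fset0. Qed.

Lemma lmulDr : right_distributive lmul +%R.
Proof. by move=> p q r; rewrite lmulC lmulDl ![lmul _ p]lmulC. Qed.

Lemma lmulr0 : right_zero 0 lmul.
Proof. by move=> p; rewrite lmulC lmul0. Qed.

Lemma lmulUU c1 c2 a1 a2 :
  lmul << c1 *g a1 >> << c2 *g a2 >> = << c1 * c2 *g a1 + a2 >>.
Proof. by rewrite (lmulw msuppU_le msuppU_le) !big_seq_fset1 !mcoeffUU. Qed.

Lemma lmul_suml (T : Type) (r : seq T) (f : T -> laurent) q :
  lmul (\sum_(i <- r) f i) q = \sum_(i <- r) lmul (f i) q.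
Proof. exact: (big_morph (lmul^~ q) (fun _ _ => lmulDl _ _ _) (lmul0 _)). Qed.

Lemma lmul_sumr (T : Type) (r : seq T) (f : T -> laurent) p :
  lmul p (\sum_(i <- r) f i) = \sum_(i <- r) lmul p (f i).
Proof. exact: (big_morph (lmul p) (fun _ _ => lmulDr _ _ _) (lmulr0 _)). Qed.

Lemma lmulA : associative lmul.
Proof.
move=> p q r; rewrite [p]monalgE [q]monalgE [r]monalgE.
set P := \sum_(k <- _) _; set Q := \sum_(k <- _) _; set S := \sum_(k <- _) _.
rewrite [LHS]lmul_suml [lmul P Q]lmul_suml [RHS]lmul_suml; apply: eq_bigr => a _.
rewrite [lmul Q S]lmul_suml [lmul _ Q]lmul_sumr lmul_suml lmul_sumr.
apply: eq_bigr => b _; rewrite [lmul _ S]lmul_sumr [LHS]lmul_sumr [RHS]lmul_sumr.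
by apply: eq_bigr => c _; rewrite !lmulUU mulrA addrA.
Qed.

Lemma lmul1 : left_id lone lmul.
Proof.
move=> p; rewrite [p]monalgE lmul_sumr; apply: eq_bigr => a _.
by rewrite lmulUU mul1r add0r.
Qed.

Lemma lone_neq0 : lone != 0 :> laurent.
Proof. by rewrite monalgU_eq0 oner_eq0. Qed.

HB.instance Definition _ := GRing.Zmodule_isComNzRing.Build laurent
  lmulA lmulC lmul1 lmulDl lone_neq0.

Definition toLaurent (p : polyring K F) : laurent :=
  \sum_(m <- msupp p) << p@_m *g [ffun e => (m e)%:Z] >>.

Definition homog0 (p : laurent) : Prop :=
  forall a, a \in msupp p -> \sum_e a e = 0.

Lemma homog0_subring_closed :
  [/\ homog0 1, forall p q, homog0 p -> homog0 q -> homog0 (p - q)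
    & forall p q, homog0 p -> homog0 q -> homog0 (p * q)].
Proof.
have sub2 (p q r : laurent) : (msupp r `<=` msupp p `|` msupp q)%fset ->
    homog0 p -> homog0 q -> homog0 r.
  move=> /fsubsetP sub hp hq a /sub; rewrite in_fsetU => /orP[]; [exact: hp|].
  exact: hq.
split=> [a|p q|p q hp hq].
- rewrite [msupp _]msuppU oner_eq0 in_fset1 => /eqP ->.
  by rewrite big1 // => e _; rewrite ffunE.
- exact/sub2/msuppB_le.
- rewrite [p * q]/(lmul p q) /lmul big_seq.
  elim/big_ind: _ => [a|r s hr hs|a ap]; first by rewrite msupp0 in_fset0.
    exact: (sub2 _ _ _ (msuppD_le _ _) hr hs).
  rewrite big_seq.
  elim/big_ind: _ => [b|r s hr hs|b bq c]; first by rewrite msupp0 in_fset0.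
    exact: (sub2 _ _ _ (msuppD_le _ _) hr hs).
  move/(fsubsetP msuppU_le); rewrite in_fset1 => /eqP ->.
  under eq_bigr do rewrite ffunE.
  by rewrite big_split /= (hp _ ap) (hq _ bq) addr0.
Qed.

Section Degree0.
Variable X : set laurent.

(** The degree-0 part of the quotient of the Laurent polynomial ring by the
    ideal generated by [X] (which is homogeneous in all uses below). *)
Definition deg0_pred : {pred quotient X} :=
  fun z => `[< exists2 p, homog0 p & z = qproj X p >].

Lemma deg0_subring : subring_closed deg0_pred.
Proof.
have [h1 hB hM] := homog0_subring_closed.
split=> [|_ _ /asboolP[p hp ->] /asboolP[q hq ->]|
    _ _ /asboolP[p hp ->] /asboolP[q hq ->]]; apply/asboolP.
- by exists 1.
- by exists (p - q); [exact: hB|rewrite qprojD qprojN].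
- by exists (p * q); [exact: hM|rewrite qprojM].
Qed.

Definition deg0 := {z : quotient X | deg0_pred z}.
HB.instance Definition _ := SubChoice.on deg0.
HB.instance Definition _ := 
  GRing.SubChoice_isSubComPzRing.Build (quotient X) deg0_pred deg0 deg0_subring.

End Degree0.

End Laurent.

Section Substitution.
Variables (K : comNzRingType).

(** The map of Laurent rings renaming variables, where [g e'] is the variable
    of the source renamed to [e'], if any.  For [g] a partial inverse of an
    injection [F -> F'], this is the inclusion of Laurent rings. *)
Definition laurent_map (F F' : finType) (g : F' -> option F)
    (p : laurent K F) : laurent K F' :=
  \sum_(a <- msupp p) << p@_a *g [ffun e' => oapp a 0 (g e')] >>.

Variable E : finType.

Definition vars (D : {set E}) : finType := {e : E | e \in D}.

Definition incl (D : {set E}) : laurent K (vars D) -> laurent K E :=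
  laurent_map insub.

Definition incl_cell (D G : {set E}) :
    laurent K (vars D) -> laurent K (vars G) :=
  laurent_map (fun e : vars G => insub (val e)).

(** [rho D] substitutes [rho_var D e] for [x_e], killing the variables outside
    [D]. *)
Definition rho_var (D : {set E}) (e : E) : polyring K (vars D) :=
  oapp (fun e' => << ucm e' >>) 0 (insub e : option (vars D)).

Definition rho (D : {set E}) (p : polyring K E) : polyring K (vars D) :=
  \sum_(m <- msupp p) p@_m *: \prod_e rho_var D e ^+ m e.

End Substitution.

Section Initial.
Variables (R : realType) (E : finType).

Notation S := (polyring R[i] E).
Implicit Types (I : set S) (w : E -> R) (p : S).

Definition mrestr (P : pred {cmonom E}) p : S :=
  [malg m in msupp p => if P m then p@_m else 0].

Definition weight w (m : {cmonom E}) : R := \sum_e w e * (m e)%:R.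

Definition init_form w p : S :=
  mrestr (fun m => all (fun m' => weight w m <= weight w m') (msupp p)) p.

Definition init_ideal w I : set S := ideal_gen (init_form w @` I).

Definition homogeneous_ideal I : Prop :=
  forall p, I p -> forall d, I (mrestr (fun m => mdeg m == d) p).

Definition no_monomial I : Prop := forall m : {cmonom E}, ~ I << m >>.

Definition wcomp w (c : R) p := mrestr (fun m => weight w m == c) p.

Definition whomogeneous w I : Prop := forall p, I p -> forall c, I (wcomp w c p).

Lemma mcoeff_mrestr (P : pred {cmonom E}) p m :
  (mrestr P p)@_m = if P m then p@_m else 0.
Proof.
by rewrite /mrestr mcoeffE; case: msuppP; rewrite ?if_same.
Qed.

Lemma msupp_mrestr (P : pred {cmonom E}) p m :
  (m \in msupp (mrestr P p)) = P m && (m \in msupp p).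
Proof.
by rewrite -!mcoeff_neq0 mcoeff_mrestr; case: (P m); rewrite //= eqxx.
Qed.

Lemma mrestr_comp (P Q : pred {cmonom E}) p :
  mrestr P (mrestr Q p) = mrestr (fun m => P m && Q m) p.
Proof.
by apply/malgP => m; rewrite !mcoeff_mrestr; case: (P m); case: (Q m).
Qed.

Lemma mrestrD (P : pred {cmonom E}) p q :
  mrestr P (p + q) = mrestr P p + mrestr P q.
Proof.
apply/malgP => m; rewrite mcoeffD !mcoeff_mrestr mcoeffD.
by case: (P m); rewrite // addr0.
Qed.

Lemma mrestr0 (P : pred {cmonom E}) : mrestr P 0 = 0.
Proof. by apply/malgP => m; rewrite mcoeff_mrestr mcoeff0 if_same. Qed.

Lemma ideal_split_ind I (Q : set S) : is_ideal I -> Q 0 ->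
  (forall p q, Q p -> Q q -> Q (p + q)) ->
  (forall p, I p -> p != 0 -> exists P : pred {cmonom E},
    [/\ exists2 m, m \in msupp p & P m, I (mrestr P p) & Q (mrestr P p)]) ->
  I `<=` Q.
Proof.
move=> HI Q0 QD step p; have [n] := ubnP #|` msupp p|.
elim: n p => // n IH p; rewrite ltnS => le_n Ip.
have [->//|p0] := eqVneq p 0.
have [P [[m mp Pm] Ir Qr]] := step _ Ip p0.
rewrite -(subrK (mrestr P p) p) addrC; apply: QD => //.
apply: IH; last exact: idealB.
apply: leq_trans le_n; apply: fproper_ltn_card.
rewrite fproperE; apply/andP; split.
  apply/fsubsetP => k; rewrite -!mcoeff_neq0 mcoeffB mcoeff_mrestr.
  by case: ifP; rewrite ?subrr ?eqxx // subr0.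
apply/fsubsetPn; exists m => //.
by rewrite -mcoeff_eq0 mcoeffB mcoeff_mrestr Pm subrr.
Qed.

Lemma init_formE w p : p != 0 ->
  exists2 m0, m0 \in msupp p & init_form w p = wcomp w (weight w m0) p.
Proof.
move=> p0.
have /fset0Pn[m1 m1p] : msupp p != fset0.
  by apply: contra p0 => /eqP h; apply/eqP/malgP => m;
     rewrite mcoeff0 mcoeff_outdom // h.
pose m0 := [arg min_(m < [` m1p]%fset) weight w (val m)]%O.
have m0min m : m \in msupp p -> weight w (val m0) <= weight w m.
  by move=> mp; rewrite /m0; case: arg_minP => // i _ /(_ [` mp]%fset); apply.
exists (val m0); first exact: valP.
apply/malgP => m; rewrite !mcoeff_mrestr.
case: (msuppP p m) => [mp|_]; last by rewrite !if_same.
congr (if _ then _ else _); apply/allP/eqP => [h|-> m'].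
  by apply/eqP; rewrite eq_le m0min // h //; exact: valP.
exact: m0min.
Qed.

Lemma init_ideal_fixP w I : is_ideal I ->
  init_ideal w I = I <-> whomogeneous w I.
Proof.
move=> HI; have [I0 ID _] := HI; split=> [Iw p Ip c|hom].
  pose Q := [set p | I (wcomp w c p)].
  suff /(_ _ Ip) : I `<=` Q by [].
  apply: ideal_split_ind => // [|{Ip}p q|{Ip}p Ip p0].
  - by rewrite /Q /= /wcomp mrestr0.
  - by rewrite /Q /= /wcomp mrestrD; apply: ID.
  - have [m0 m0p e] := init_formE w p0.
    have Ii : I (wcomp w (weight w m0) p).
      by rewrite -e -Iw; apply: sub_ideal_gen; exists p.
    exists (fun m => weight w m == weight w m0); split => //.
      by exists m0.
    rewrite /Q /= /wcomp mrestr_comp.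
    have [ec|nc] := eqVneq c (weight w m0).
      rewrite ec; congr I: Ii; congr mrestr.
      by apply/funext => m; rewrite andbb.
    rewrite (_ : mrestr _ _ = 0) //; apply/malgP => m.
    rewrite mcoeff_mrestr mcoeff0; case: eqP => //= ->.
    by rewrite (negbTE nc).
apply/seteqP; split=> [p /(_ I HI)|].
  apply=> _ [q Iq <-]; have [->|q0] := eqVneq q 0.
    by rewrite /init_form mrestr0.
  by have [m0 _ ->] := init_formE w q0; apply: hom.
have HG := ideal_gen_ideal (init_form w @` I); have [G0 GD _] := HG.
apply: ideal_split_ind => // p Ip p0.
have [m0 m0p e] := init_formE w p0.
exists (fun m => weight w m == weight w m0); split => //.
- by exists m0.
- exact: hom.
- by rewrite -/(wcomp _ _ _) -e; apply: sub_ideal_gen; exists p.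
Qed.

Lemma weight_lin (a : R) v u m :
  weight (fun e => a * v e + u e) m = a * weight v m + weight u m.
Proof.
rewrite /weight mulr_sumr -big_split; apply: eq_bigr => e _.
by rewrite mulrDl mulrA.
Qed.

Lemma whomogeneous_lin (a : R) v u I : is_ideal I ->
  whomogeneous v I -> whomogeneous u I ->
  whomogeneous (fun e => a * v e + u e) I.
Proof.
move=> HI hv hu p Ip c; have [I0 ID _] := HI.
pose Q := [set p | I (wcomp (fun e => a * v e + u e) c p)].
suff /(_ _ Ip) : I `<=` Q by [].
apply: ideal_split_ind => // [|{Ip}p q|{Ip}p Ip p0].
- by rewrite /Q /= /wcomp mrestr0.
- by rewrite /Q /= /wcomp mrestrD; apply: ID.
have [m0 m0p _] := init_formE v p0.
pose P m := (weight v m == weight v m0) && (weight u m == weight u m0).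
have IP : I (mrestr P p) by rewrite -mrestr_comp; apply: hv; apply: hu.
exists P; split => //; first by exists m0; rewrite // /P !eqxx.
rewrite /Q /= /wcomp mrestr_comp.
have [ec|nc] := eqVneq (a * weight v m0 + weight u m0) c.
  congr I: IP; congr mrestr; apply/funext => m; rewrite weight_lin.
  by rewrite /P; case: eqP => [->|]; case: eqP => [->|]; rewrite ?andbF // ec eqxx.
rewrite (_ : mrestr _ _ = 0) //; apply/malgP => m.
rewrite mcoeff_mrestr mcoeff0 weight_lin /P.
case: eqP => //= e1; case: eqP => //= ev; case: eqP => //= eu.
by rewrite -ev -eu e1 eqxx in nc.
Qed.

Lemma whomogeneous0 I : is_ideal I -> whomogeneous (fun=> 0) I.
Proof.
move=> [I0 _ _] p Ip c; have w0 m : weight (fun=> 0) m = 0.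
  by rewrite /weight big1 // => e _; rewrite mul0r.
have [c0|c0] := eqVneq 0 c.
  congr I: Ip; apply/malgP => m; rewrite mcoeff_mrestr w0 c0 eqxx //.
rewrite (_ : wcomp _ _ _ = 0) //; apply/malgP => m.
by rewrite mcoeff_mrestr w0 (negbTE c0) mcoeff0.
Qed.

Lemma set_vspace (V : vectType R) (P : set V) : P 0 ->
  (forall a u v, P u -> P v -> P (a *: u + v)) ->
  exists U : {vspace V}, forall v, v \in U <-> P v.
Proof.
move=> P0 Plin.
have ex : exists n, `[< exists2 U : {vspace V}, \dim U = n & forall v, v \in U -> P v >].
  by exists 0%N; apply/asboolP; exists 0%VS; rewrite ?dimv0 // => v /[!memv0]/eqP->.
have bd n : `[< exists2 U : {vspace V}, \dim U = n & forall v, v \in U -> P v >] ->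
    (n <= \dim {:V})%N.
  by move=> /asboolP[U <- _]; apply: dimvS; apply: subvf.
case: (ex_maxnP ex bd) => n /asboolP[U dU UP] nmax.
exists U => v; split=> [/UP//|Pv].
have UvP x : x \in (U + <[v]>)%VS -> P x.
  move=> /memv_addP[u uU [_ /vlineP[k ->] ->]].
  by rewrite addrC; apply: Plin => //; apply: UP.
have le : (\dim (U + <[v]>) <= \dim U)%N.
  by rewrite dU; apply: nmax; apply/asboolP; exists (U + <[v]>)%VS.
have /eqP -> : U == (U + <[v]>)%VS by rewrite eqEdim addvSl.
by rewrite memvE addvSr.
Qed.

(** [L(I)], the linear subspace of the [w] with [in_w I = I]; see
    [lineality_spaceP]. *)
Definition lineality_space I : {vspace {ffun E -> R^o}} :=
  xget 0%VS [set L : {vspace {ffun E -> R^o}} |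
             forall v, v \in L <-> init_ideal v I = I].

Lemma lineality_spaceP I : is_ideal I ->
  forall v, v \in lineality_space I <-> init_ideal v I = I.
Proof.
move=> HI; rewrite /lineality_space; case: xgetP => //= none; exfalso.
have [|a u v /(init_ideal_fixP _ HI) hu /(init_ideal_fixP _ HI) hv|U UP] :=
    @set_vspace {ffun E -> R^o} [set v | init_ideal v I = I].
- apply/(init_ideal_fixP _ HI); congr (whomogeneous _ I): (whomogeneous0 HI).
  by apply/funext => e; rewrite ffunE.
- apply/(init_ideal_fixP _ HI).
  congr (whomogeneous _ I): (whomogeneous_lin a HI hu hv).
  by apply/funext => e; rewrite !ffunE.
- exact: (none U).
Qed.

(** [E_f], for a point configuration [a] and a linear functional [f]. *)
Definition minimizers (V : vectType R) (a : E -> V) w (f : 'Hom(V, R^o)) :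
    {set E} :=
  [set e | [forall e', (f (a e) + w e : R) <= f (a e') + w e']].

(** A cell is recorded by its set of labels. *)
Definition is_cell (V : vectType R) (a : E -> V) w (D : {set E}) : Prop :=
  exists f, D = minimizers a w f.

Definition lineality_dual I := 'Hom(subvs_of (lineality_space I), R^o).

(** [A(I)], the restrictions to [L(I)] of the coordinate functionals. *)
Definition configuration I (e : E) : lineality_dual I :=
  linfun (fun v : subvs_of (lineality_space I) => vsval v e).

Lemma configurationE I (e : E) (v : subvs_of (lineality_space I)) :
  configuration I e v = vsval v e.
Proof.
have lin : linear (fun v : subvs_of (lineality_space I) => vsval v e : R^o).
  by move=> a u u'; rewrite linearP !ffunE.
pose f := GRing.isLinear.Build _ _ _ _ _ lin.
pose g : {linear subvs_of (lineality_space I) -> R^o} := HB.pack (fun v => _) f.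
exact: (lfunE g v).
Qed.

(** The cells of [subd_w A(I)], ordered by [cell_le]. *)
Definition cell I w : Type := {D : {set E} | is_cell (configuration I) w D}.

Definition cell_le I w (D G : cell I w) : Prop := sval D \subset sval G.

Definition init_scheme I w : affineScheme :=
  Spec (deg0 (@toLaurent R[i] E @` init_ideal w I)).

Definition cell_scheme I (D : {set E}) : affineScheme :=
  Spec (deg0 (@toLaurent R[i] (vars D) @` (rho D @` I))).

End Initial.

(** [phi] is induced on the degree-0 parts by a map [i] of Laurent rings. *)
Definition induced_by (K : comNzRingType) (F F' : finType)
    (X : set (laurent K F)) (X' : set (laurent K F'))
    (i : laurent K F -> laurent K F') (phi : deg0 X -> deg0 X') : Prop :=
  forall (z : deg0 X) p, val z = qproj X p -> val (phi z) = qproj X' (i p).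

(* Main.v *)
(** A cell [D] is the set of minimizers of [v + w] for some [v] in the lineality
    space.  As [I] is homogeneous for the degree and for [v], the part of any
    [p] in [I] supported on the variables of [D] is a sum of [w]-initial forms,
    whence the maps to the [X_D]; for a face [D] of [G] the same argument with
    the difference of the two vectors shows that [I_D] is contained in [I_G].

    The mediating morphism is a closed immersion as soon as its comorphism is
    surjective.  Its image contains the constants and [x_e / x_e'] for [e, e']
    in a common cell.  Moving along a segment in the space of functionals, the
    cell changes through cells sharing labels, so that any two labels covered
    by cells are joined by a chain of cells; hence the image contains all
    [x_e / x_e'], which generate the degree-0 Laurent polynomials. *)
Require Import Defs.
From HB Require Import structures.
From mathcomp Require Import all_boot all_order all_algebra.
From mathcomp Require Import finmap.
From mathcomp Require Import boolp classical_sets reals.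
From mathcomp Require Import complex monalg.
From mathcomp Require Import ring.

Set Implicit Arguments.
Unset Strict Implicit.
Unset Printing Implicit Defensive.

Import Order.TTheory GRing.Theory Num.Theory.
Local Open Scope classical_set_scope.
Local Open Scope ring_scope.

(** * Limits of affine schemes, and a criterion for closed immersions *)

Section Colimit.
Local Open Scope quotient_scope.
Variables (J : Type) (le : J -> J -> Prop) (D : J -> affineScheme).
Variable t : forall i j, le i j -> (D j ~> D i).

(** Formal ring expressions in elements of the coordinate rings; the colimit of the rings is a
    quotient of these terms. *)
Inductive colim_term : Type :=
| CVar i of coordRing (D i)
| CZero
| COne
| COpp of colim_term
| CAdd of colim_term & colim_term
| CMul of colim_term & colim_term.

HB.instance Definition _ := gen_eqMixin colim_term.
HB.instance Definition _ := gen_choiceMixin colim_term.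

Fixpoint colim_eval (A : comPzRingType) (v : forall i, coordRing (D i) -> A)
    (x : colim_term) : A :=
  match x with
  | CVar i a => v i a
  | CZero => 0
  | COne => 1
  | COpp x => - colim_eval v x
  | CAdd x y => colim_eval v x + colim_eval v y
  | CMul x y => colim_eval v x * colim_eval v y
  end.

(** Identifying terms that every cone evaluates equally enforces the ring axioms and the
    compatibility with [t] at once, and evaluation at any cone descends to the quotient by
    construction. *)
Definition colim_eqv (x y : colim_term) : Prop :=
  forall (A : affineScheme) (v : forall i, A ~> D i),
    is_cone t v -> colim_eval v x = colim_eval v y.

Definition colim_rel (x y : colim_term) : bool := `[< colim_eqv x y >].

Lemma colim_rel_equiv : equiv_class_of colim_rel.
Proof.
split=> [x|x y|y x z].
- exact/asboolP.
- by apply/asboolP/asboolP => xy A v vt; rewrite xy.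
- move=> /asboolP xy /asboolP yz; apply/asboolP => A v vt.
  by rewrite xy // yz.
Qed.

Canonical colim_rel_equivRel := EquivRelPack colim_rel_equiv.
Canonical colim_rel_encModRel := defaultEncModRel colim_rel.

Definition colim_ring := {eq_quot colim_rel}.
HB.instance Definition _ : EqQuotient colim_term colim_rel colim_ring :=
  EqQuotient.on colim_ring.
HB.instance Definition _ := Choice.on colim_ring.

Let pr (x : colim_term) : colim_ring := \pi_colim_ring x.

Let prP x y : pr x = pr y <-> colim_eqv x y.
Proof.
split=> [/eqP|H]; last apply/eqP; rewrite /pr piE; last exact/asboolP.
by move/asboolP.
Qed.

Let prK (q : colim_ring) : pr (repr q) = q. Proof. exact: reprK. Qed.
Let reprE x : colim_eqv (repr (pr x)) x. Proof. by apply/prP; rewrite prK. Qed.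

Let copp (q : colim_ring) : colim_ring := pr (COpp (repr q)).
Let cadd (q r : colim_ring) : colim_ring := pr (CAdd (repr q) (repr r)).
Let cmul (q r : colim_ring) : colim_ring := pr (CMul (repr q) (repr r)).

Let coppE x : copp (pr x) = pr (COpp x).
Proof. by apply/prP => A v vt /=; rewrite (reprE x vt). Qed.
Let caddE x y : cadd (pr x) (pr y) = pr (CAdd x y).
Proof. by apply/prP => A v vt /=; rewrite (reprE x vt) (reprE y vt). Qed.
Let cmulE x y : cmul (pr x) (pr y) = pr (CMul x y).
Proof. by apply/prP => A v vt /=; rewrite (reprE x vt) (reprE y vt). Qed.

Let caddA : associative cadd.
Proof.
move=> x y z; rewrite -[x]prK -[y]prK -[z]prK !caddE.
by apply/prP => A v _ /=; rewrite addrA.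
Qed.
Let caddC : commutative cadd.
Proof.
move=> x y; rewrite -[x]prK -[y]prK !caddE.
by apply/prP => A v _ /=; rewrite addrC.
Qed.
Let cadd0 : left_id (pr CZero) cadd.
Proof.
by move=> x; rewrite -[x]prK caddE; apply/prP => A v _ /=; rewrite add0r.
Qed.
Let caddN : left_inverse (pr CZero) copp cadd.
Proof.
move=> x; rewrite -[x]prK coppE caddE.
by apply/prP => A v _ /=; rewrite addNr.
Qed.

HB.instance Definition _ :=
  GRing.isZmodule.Build colim_ring caddA caddC cadd0 caddN.

Let cmulA : associative cmul.
Proof.
move=> x y z; rewrite -[x]prK -[y]prK -[z]prK !cmulE.
by apply/prP => A v _ /=; rewrite mulrA.
Qed.
Let cmulC : commutative cmul.
Proof.
move=> x y; rewrite -[x]prK -[y]prK !cmulE.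
by apply/prP => A v _ /=; rewrite mulrC.
Qed.
Let cmul1 : left_id (pr COne) cmul.
Proof.
by move=> x; rewrite -[x]prK cmulE; apply/prP => A v _ /=; rewrite mul1r.
Qed.
Let cmulD : left_distributive cmul +%R.
Proof.
move=> x y z; rewrite -[x]prK -[y]prK -[z]prK.
rewrite [_ + _]caddE !cmulE [RHS]caddE.
by apply/prP => A v _ /=; rewrite mulrDl.
Qed.

HB.instance Definition _ :=
  GRing.Zmodule_isComPzRing.Build colim_ring cmulA cmulC cmul1 cmulD.

(** A limit of affine schemes is a colimit of rings: the classes of variables form the cone, and
    evaluation of terms gives the mediating comorphism. *)
Lemma affine_limit_exists :
  exists (L : affineScheme) (q : forall i, L ~> D i), is_limit t q.
Proof.
pose inj i (a : coordRing (D i)) : colim_ring := pr (CVar a).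
have injB i : zmod_morphism (inj i).
  move=> a b; rewrite [- inj i b]coppE [RHS]caddE.
  by apply/prP => A v _ /=; rewrite rmorphB.
have injM i : monoid_morphism (inj i).
  split=> [|a b]; first by apply/prP => A v _ /=; rewrite rmorph1.
  by rewrite [RHS]cmulE; apply/prP => A v _ /=; rewrite rmorphM.
pose q i : Spec colim_ring ~> D i :=
  HB.pack (inj i) (GRing.isZmodMorphism.Build _ _ _ (injB i))
    (GRing.isMonoidMorphism.Build _ _ _ (injM i)).
exists (Spec colim_ring), q; split=> [i j h a|X p pt].
  by apply/prP => A v vt; apply: vt.
pose ev (z : colim_ring) : coordRing X := colim_eval p (repr z).
have evE x : ev (pr x) = colim_eval p x.
  exact: reprE pt.
have evB : zmod_morphism ev.
  move=> x y; rewrite -[x]prK -[y]prK [- _]coppE [_ + _]caddE.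
  by rewrite !evE.
have evM : monoid_morphism ev.
  split=> [|x y]; first by rewrite [LHS]evE.
  by rewrite -[x]prK -[y]prK [_ * _ in LHS]cmulE !evE.
pose u : X ~> Spec colim_ring :=
  HB.pack ev (GRing.isZmodMorphism.Build _ _ _ evB)
    (GRing.isMonoidMorphism.Build _ _ _ evM).
exists u => [i a|u' u'p z]; first exact: evE.
rewrite -[z]prK [RHS]evE.
(* Every element is the class of a term, so a mediating comorphism is determined by its values on
   the variables. *)
elim: (repr z) => {z} [i a|||x IHx|x IHx y IHy|x IHx y IHy] /=.
- exact: u'p.
- exact: (rmorph0 u').
- exact: (rmorph1 u').
- by rewrite -coppE (rmorphN u') IHx.
- by rewrite -caddE (rmorphD u') IHx IHy.
- by rewrite -cmulE (rmorphM u') IHx IHy.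
Qed.

End Colimit.

(** Points of [X] correspond to the primes of [coordRing Y] that contain the kernel of [u], and
    fractions lift by lifting numerator and denominator separately. *)
Lemma closed_immersion_surj (X Y : affineScheme) (u : X ~> Y) :
  (forall b, exists a, u a = b) -> closed_immersion u.
Proof.
move=> surj; split.
- move=> [P HP] [Q HQ] /(congr1 sval) /= PQ; apply: eq_exist.
  apply/seteqP; split=> b; have [a <-] := surj b.
    by move=> Pa; have : (u @^-1` P) a by []; rewrite PQ.
  by move=> Qa; have : (u @^-1` Q) a by []; rewrite -PQ.
- move=> Z; split=> [[F ->]|[_ [F ->] ->]].
    exists [set y | u @^-1` F `<=` sval y]; first by exists (u @^-1` F).
    apply/seteqP; split=> x /= FP a; first exact: FP.
    by have [b <-] := surj a => Fb; apply: FP.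
  exists (u @` F); apply/seteqP; split=> x /= FP.
    by move=> _ [a Fa <-]; apply: FP.
  by move=> a Fa; apply: FP; exists a.
- exists [set a | u a = 0]; apply/seteqP; split=> [_ [[P HP] _ <-] a /= ->|].
    by case: HP => -[].
  move=> [P HP] /= kerP; have [[P0 PD PM] P1 Pp] := HP.
  have uP a : (u @` P) (u a) -> P a.
    move=> [b Pb ba]; rewrite -(subrK b a); apply: PD => //.
    by apply: kerP; rewrite /= rmorphB ba subrr.
  have HQ : is_prime_ideal (u @` P).
    split=> [||a b].
    + split.
      * by exists 0; rewrite ?rmorph0.
      * move=> _ _ [a Pa <-] [b Pb <-]; exists (a + b); first exact: PD.
        by rewrite rmorphD.
      * move=> a' _ [b Pb <-]; have [a <-] := surj a'.
        by exists (a * b); rewrite ?rmorphM //; apply: PM.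
    + by move=> Q1; apply/P1/uP; rewrite rmorph1.
    + have [a' <-] := surj a; have [b' <-] := surj b.
      by rewrite -rmorphM => /uP /Pp [Pa|Pb]; [left|right]; eexists; eauto.
  exists (exist _ _ HQ) => //; apply: eq_exist => /=.
  by apply/seteqP; split=> a /= => [/uP|Pa] //; exists a.
- move=> [P HP] a s /= Ps.
  have [b ub] := surj a; have [r ur] := surj s.
  exists b, r; split; first by rewrite /= ur.
  by exists 1; rewrite /= ?ub ?ur; [case: HP|rewrite mul1r mulrC subrr].
Qed.

(** * Renaming of variables in Laurent rings *)

Section LaurentMap.
Variables (K : comNzRingType).

Lemma laurentE (F : finType) (p : laurent K F) :
  p = \sum_(a <- msupp p) (<< p@_a *g a >> : laurent K F) :> laurent K F.
Proof. exact: monalgE. Qed.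

Section Morphism.
Variables (F F' : finType) (g : F' -> option F).

Definition exp_map (a : {ffun F -> int}) : {ffun F' -> int} :=
  [ffun e' => oapp a 0 (g e')].

Lemma exp_mapD a b : exp_map (a + b) = exp_map a + exp_map b.
Proof. by apply/ffunP => e; rewrite !ffunE; case: (g e) => //= x; rewrite ffunE. Qed.

Lemma exp_map0 : exp_map 0 = 0.
Proof. by apply/ffunP => e; rewrite !ffunE; case: (g e) => //= x; rewrite ffunE. Qed.

(** Freedom in the index set lets additivity be checked on a common set containing both supports. *)
Lemma laurent_mapEw (d : {fset {ffun F -> int}}) (p : laurent K F) :
  (msupp p `<=` d)%fset ->
  laurent_map g p = \sum_(a <- d) << p@_a *g exp_map a >>.
Proof.
move=> le; rewrite /laurent_map (big_fset_incl _ le) //= => a _.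
by move/mcoeff_outdom ->; rewrite monalgU0.
Qed.

Lemma laurent_mapU c a :
  laurent_map g (<< c *g a >> : laurent K F) = << c *g exp_map a >>.
Proof. by rewrite (laurent_mapEw msuppU_le) big_seq_fset1 mcoeffUU. Qed.

Lemma laurent_map_is_additive :
  zmod_morphism (laurent_map g : laurent K F -> laurent K F').
Proof.
move=> p q; rewrite (laurent_mapEw (msuppB_le p q)).
rewrite (laurent_mapEw (fsubsetUl (msupp p) (msupp q))).
rewrite (laurent_mapEw (fsubsetUr (msupp p) (msupp q))) -sumrB.
by apply: eq_bigr => a _; rewrite mcoeffB monalgUB.
Qed.

HB.instance Definition _ := GRing.isZmodMorphism.Build _ _
  (laurent_map g : laurent K F -> laurent K F') laurent_map_is_additive.

Lemma laurent_map_is_multiplicative :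
  monoid_morphism (laurent_map g : laurent K F -> laurent K F').
Proof.
split=> [|p q]; first by rewrite [LHS]laurent_mapU exp_map0.
have sumM (r s : laurent K F) : r * s =
    \sum_(a <- msupp r) \sum_(b <- msupp s)
      (<< r@_a * s@_b *g a + b >> : laurent K F) :> laurent K F by [].
rewrite sumM (raddf_sum (laurent_map g)).
rewrite [p in RHS]laurentE (raddf_sum (laurent_map g)) mulr_suml.
apply: eq_bigr => a _.
rewrite (raddf_sum (laurent_map g)) [q in RHS]laurentE (raddf_sum (laurent_map g)).
rewrite mulr_sumr; apply: eq_bigr => b _.
by rewrite /= !laurent_mapU [RHS]lmulUU exp_mapD.
Qed.

HB.instance Definition _ := GRing.isMonoidMorphism.Build _ _
  (laurent_map g : laurent K F -> laurent K F') laurent_map_is_multiplicative.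

(** Here [g] is the partial inverse of the injection [h], so exponents are extended by zero off the
    image of [h] and their sum is unchanged. *)
Lemma laurent_map_homog0 (h : F -> F') (p : laurent K F) : pcancel h g ->
  (forall e' e, g e' = Some e -> h e = e') ->
  homog0 p -> homog0 (laurent_map g p).
Proof.
move=> hK gK hp; rewrite /laurent_map big_seq.
elim/big_ind: _ => [a|r s hr hs a|a ap b].
- by rewrite msupp0 in_fset0.
- by move/(fsubsetP (msuppD_le _ _)); rewrite in_fsetU => /orP[/hr|/hs].
move/(fsubsetP msuppU_le); rewrite in_fset1 => /eqP ->.
rewrite -[RHS](hp a ap).
under eq_bigr do rewrite ffunE.
rewrite (bigID (fun e' => isSome (g e'))) /= [X in _ + X]big1 ?addr0.
  rewrite (reindex_omap h g) => [|e']; last first.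
    by case ge: (g e') => [e|//] _ /=; rewrite (gK _ _ ge).
  by apply: eq_big => e; rewrite hK ?eqxx.
by move=> e'; case: (g e').
Qed.

End Morphism.

Lemma laurent_map_comp (F F' F'' : finType) (g : F' -> option F)
    (g' : F'' -> option F') (p : laurent K F) :
  laurent_map g' (laurent_map g p) = laurent_map (fun e => obind g (g' e)) p.
Proof.
rewrite [laurent_map g p]/laurent_map (raddf_sum (laurent_map g')).
apply: eq_bigr => a _; rewrite /= laurent_mapU; congr mkmalgU.
by apply/ffunP => e; rewrite !ffunE; case: (g' e) => //= e'; rewrite ffunE.
Qed.

Lemma laurent_map_id (F : finType) (p : laurent K F) :
  laurent_map (@Some F) p = p.
Proof.
rewrite [RHS]laurentE; apply: eq_bigr => a _; congr mkmalgU.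
by apply/ffunP => e; rewrite ffunE.
Qed.

End LaurentMap.

(** * Degree-0 parts and the morphisms induced on them *)

Section Deg0Val.
Variables (K : comNzRingType) (F : finType) (X : set (laurent K F)).
Implicit Types y z : deg0 X.

Lemma deg0P z : exists2 p, homog0 p & val z = qproj X p.
Proof. by case: z => z /= /asboolP. Qed.

Lemma deg0_val1 : val (1 : deg0 X) = 1. Proof. exact: rmorph1. Qed.
Lemma deg0_valD y z : val (y + z) = val y + val z. Proof. exact: rmorphD. Qed.
Lemma deg0_valB y z : val (y - z) = val y - val z. Proof. exact: rmorphB. Qed.
Lemma deg0_valM y z : val (y * z) = val y * val z. Proof. exact: rmorphM. Qed.

End Deg0Val.

Section InducedMap.
Variables (K : comNzRingType) (F F' : finType).
Variables (X : set (laurent K F)) (X' : set (laurent K F')).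

(** The map applies [f] to a chosen representative; as [f] carries the first ideal into the second,
    any other representative gives the same class. *)
Lemma induced_exists (f : {rmorphism laurent K F -> laurent K F'}) :
  (forall p, X p -> ideal_gen X' (f p)) ->
  (forall p, homog0 p -> homog0 (f p)) ->
  exists phi : {rmorphism deg0 X -> deg0 X'}, induced_by f phi.
Proof.
move=> fX fh; have [J0 JD JM] := ideal_gen_ideal X'.
have fJ p : ideal_gen X p -> ideal_gen X' (f p).
  move=> /(_ (f @^-1` ideal_gen X')); apply=> //; split=> [|a b|a b] /=.
  - by rewrite rmorph0.
  - by rewrite rmorphD; exact: JD.
  - by rewrite rmorphM; exact: JM.
have fE (z : deg0 X) p : val z = qproj X p ->
    qproj X' (f (repr (val z))) = qproj X' (f p).
  move=> zp; apply/qprojP; rewrite -rmorphB; apply: fJ.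
  apply/qprojP.
  exact: etrans (qprojK _) zp.
have f0 (z : deg0 X) : deg0_pred (qproj X' (f (repr (val z)))).
  (* The representative picked by [repr] may fail to be of degree 0, so it is traded for [p], which
     is. *)
  have [p hp zp] := deg0P z; apply/asboolP; exists (f p); first exact: fh.
  exact: fE.
pose phi (z : deg0 X) : deg0 X' := Sub _ (f0 z).
have phiE z p : val z = qproj X p -> val (phi z) = qproj X' (f p).
  by move=> zp; rewrite SubK; apply: fE.
have phiB : zmod_morphism phi.
  move=> y z; apply: val_inj; have [p _ yp] := deg0P y; have [q _ zq] := deg0P z.
  rewrite deg0_valB (phiE _ _ yp) (phiE _ _ zq) (phiE _ (p - q)).
    by rewrite rmorphB qprojD qprojN.
  by rewrite deg0_valB yp zq qprojD qprojN.
have phiM : monoid_morphism phi.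
  split=> [|y z]; apply: val_inj.
    by rewrite (phiE _ 1) ?deg0_val1 ?rmorph1.
  have [p _ yp] := deg0P y; have [q _ zq] := deg0P z.
  rewrite deg0_valM (phiE _ _ yp) (phiE _ _ zq) (phiE _ (p * q)).
    by rewrite rmorphM qprojM.
  by rewrite deg0_valM yp zq qprojM.
pose psi : {rmorphism deg0 X -> deg0 X'} := HB.pack phi (GRing.isZmodMorphism.Build _ _ _ phiB)
  (GRing.isMonoidMorphism.Build _ _ _ phiM).
by exists psi.
Qed.

End InducedMap.

(** * Monomials, and the effect of killing variables *)

Section Monomials.
Variable K : comNzRingType.

Lemma monalgZ_if (T : choiceType) (b : bool) (c : K) (a : T) :
  c *: (if b then << a >> else 0) = (if b then << c *g a >> else 0)
  :> {malg K[T]}.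
Proof.
case: b; last by rewrite scaler0.
by apply/malgP => k; rewrite mcoeffZ !mcoeffU mulrnAr mulr1.
Qed.

Lemma eq_monalgU_if (T : choiceType) (b : bool) (c d : K) (a : T) :
  (b -> c = d) ->
  (if b then << c *g a >> else 0) = (if b then << d *g a >> else 0)
  :> {malg K[T]}.
Proof. by case: b => // ->. Qed.

Lemma monalgMUU (M : conomType) (a b : M) :
  << a >> * << b >> = << mmul a b >> :> {malg K[M]}.
Proof. by have := fgmulUU (1 : K) 1 a b; rewrite mulr1. Qed.

Lemma monalg_prodU (M : conomType) (T : Type) (r : seq T) (k : T -> M) :
  \prod_(i <- r) << k i >> = << \big[mmul/mone]_(i <- r) k i >> :> {malg K[M]}.
Proof.
apply: esym; apply: (big_morph (fun k => << k >> : {malg K[M]})) => // a b.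
by rewrite monalgMUU.
Qed.

Lemma monalg_expU (M : conomType) (u : M) n :
  << u >> ^+ n = << iter n (mmul u) mone >> :> {malg K[M]}.
Proof. by elim: n => [|n IH]; rewrite ?expr0 // exprS IH monalgMUU. Qed.

Lemma monom_expE (F : choiceType) (u : {cmonom F}) n e :
  (iter n (mmul u) mone : {cmonom F}) e = (u e * n)%N.
Proof.
elim: n => [|n IH]; first by rewrite cm1 muln0.
by rewrite /= cmM IH mulnS.
Qed.

End Monomials.

Section Restriction.
Variables (K : comNzRingType) (E : finType).
Implicit Types (D G : {set E}) (m : {cmonom E}) (p : polyring K E).

Definition mexp (F : finType) (m : {cmonom F}) : {ffun F -> int} :=
  [ffun e => (m e)%:Z].

Definition msupp_in D m : bool := [forall e, (m e != 0%N) ==> (e \in D)].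

Definition mres D m : {cmonom (vars D)} :=
  [cmonom m (val e) | e in [fset e | e in {: vars D}]%fset]%M.

Lemma mresE D m (e : vars D) : mres D m e = m (val e).
Proof. by rewrite cmE fsfun_fun in_fset. Qed.

Lemma toLaurentEw (F : finType) (d : {fset {cmonom F}}) (p : polyring K F) :
  (msupp p `<=` d)%fset ->
  toLaurent p = \sum_(m <- d) (<< p@_m *g mexp m >> : laurent K F).
Proof.
move=> le; rewrite /toLaurent (big_fset_incl _ le) //= => m _.
by move/mcoeff_outdom ->; rewrite monalgU0.
Qed.

Lemma toLaurentU (F : finType) (c : K) (m : {cmonom F}) :
  toLaurent (<< c *g m >> : polyring K F) = << c *g mexp m >>.
Proof. by rewrite (toLaurentEw msuppU_le) big_seq_fset1 mcoeffUU. Qed.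

Lemma toLaurent_is_additive (F : finType) :
  zmod_morphism (@toLaurent K F).
Proof.
move=> p q; rewrite (toLaurentEw (msuppB_le p q)).
rewrite (toLaurentEw (fsubsetUl (msupp p) (msupp q))).
rewrite (toLaurentEw (fsubsetUr (msupp p) (msupp q))) -sumrB.
by apply: eq_bigr => a _; rewrite mcoeffB monalgUB.
Qed.

HB.instance Definition _ (F : finType) := GRing.isZmodMorphism.Build _ _
  (@toLaurent K F) (@toLaurent_is_additive F).

(** A killed variable contributes [0 ^+ m e], which is 1 for exponent 0 and 0 otherwise; the
    remaining factors multiply to the restricted monomial. *)
Lemma rho_monom D m :
  \prod_e rho_var K D e ^+ m e = if msupp_in D m then << mres D m >> else 0.
Proof.
case: ifPn => [/forallP mD|/forallPn[e]]; last first.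
  rewrite negb_imply => /andP[me eD]; rewrite (bigD1 e) //=.
  by rewrite /rho_var insubF ?(negbTE eD) //= expr0n (negbTE me) mul0r.
rewrite (bigID (mem D)) /= mulrC big1 ?mul1r => [|e eD]; last first.
  by have := mD e; rewrite (negbTE eD) implybF negbK => /eqP ->.
rewrite (reindex_omap (val : vars D -> E) insub) /= => [|e eD]; last first.
  by rewrite insubT.
rewrite (eq_bigl predT) => [|e]; last by rewrite valK eqxx (valP e).
pose k (e : vars D) : {cmonom (vars D)} :=
  iter (m (val e)) (mmul (ucm e)) mone.
rewrite (eq_bigr (fun e => << k e >>)) => [|e _]; last first.
  by rewrite /rho_var valK /=; apply: monalg_expU.
rewrite monalg_prodU.
suff -> : \big[mmul/mone]_e k e = mres D m by [].
apply/eqP/cmP => e.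
rewrite mresE (big_morph (fun m : {cmonom (vars D)} => m e) (cmM e) (cm1 e)).
rewrite (bigD1 e) //= big1 => [|e' ne]; rewrite monom_expE ucmE.
  by rewrite eqxx mul1n addn0.
by rewrite (negbTE ne).
Qed.

Lemma rhoEw (d : {fset {cmonom E}}) D p : (msupp p `<=` d)%fset ->
  rho D p =
    \sum_(m <- d) if msupp_in D m then << p@_m *g mres D m >> else 0.
Proof.
move=> le; rewrite /rho (big_fset_incl _ le) //= => [|m _]; last first.
  by move/mcoeff_outdom ->; rewrite scale0r.
apply: eq_bigr => m _; rewrite rho_monom.
exact: monalgZ_if.
Qed.

Lemma rho_is_additive D : zmod_morphism (@rho K E D).
Proof.
move=> p q; rewrite (rhoEw _ (msuppB_le p q)).
rewrite (rhoEw _ (fsubsetUl (msupp p) (msupp q))).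
rewrite (rhoEw _ (fsubsetUr (msupp p) (msupp q))) -sumrB.
apply: eq_bigr => a _; rewrite mcoeffB monalgUB.
by case: ifP; rewrite ?subr0.
Qed.

HB.instance Definition _ D := GRing.isZmodMorphism.Build _ _
  (@rho K E D) (rho_is_additive D).

End Restriction.

Section RestrictionComplex.
Variables (R : realType) (E : finType).
Local Notation S := (polyring R[i] E).
Implicit Types (D G : {set E}) (m : {cmonom E}) (p : S).

Lemma msupp_mrestr_le (P : pred {cmonom E}) p :
  (msupp (mrestr P p) `<=` msupp p)%fset.
Proof. by apply/fsubsetP => m; rewrite msupp_mrestr => /andP[]. Qed.

(** A monomial that survives [rho D] has exponent 0 outside [D], so extending its restriction by
    zero recovers it. Membership of the image of [rho D p] thus becomes a question about a
    truncation of [p]. *)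
Lemma incl_toLaurent_rho D p :
  incl (toLaurent (rho D p)) = toLaurent (mrestr (msupp_in D) p).
Proof.
rewrite (rhoEw _ (fsubset_refl _)) (toLaurentEw (msupp_mrestr_le _ _)).
rewrite (raddf_sum (@toLaurent _ _)) /incl (raddf_sum (laurent_map _)).
apply: eq_bigr => m _; rewrite mcoeff_mrestr; case: ifP => [/forallP mD|_].
  rewrite /= toLaurentU laurent_mapU; congr mkmalgU.
  apply/ffunP => e; rewrite !ffunE; case: insubP => [e' eD <-|eD] /=.
    by rewrite ffunE mresE.
  by have := mD e; rewrite (negbTE eD) implybF negbK => /eqP ->.
by rewrite monalgU0 (raddf0 (@toLaurent _ _)) (raddf0 (laurent_map _)).
Qed.

Lemma incl_cell_toLaurent_rho D G p : D \subset G ->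
  @incl_cell R[i] E D G (toLaurent (rho D p)) =
    toLaurent (rho G (mrestr (msupp_in D) p)).
Proof.
move=> /fintype.subsetP DG.
rewrite (rhoEw _ (fsubset_refl _)) (rhoEw _ (msupp_mrestr_le _ _)).
rewrite !(raddf_sum (@toLaurent _ _)) /incl_cell (raddf_sum (laurent_map _)).
apply: eq_bigr => m _; rewrite mcoeff_mrestr; case: ifP => [mD|_]; last first.
  by rewrite monalgU0 if_same !(raddf0 (@toLaurent _ _)) (raddf0 (laurent_map _)).
have mG : msupp_in G m.
  apply/fintype.forallP => e; apply/implyP => me; apply: DG.
  exact: (implyP (fintype.forallP mD e) me).
rewrite mG /= !toLaurentU laurent_mapU; congr mkmalgU.
apply/ffunP => e; rewrite !ffunE mresE; case: insubP => [e' eD ee|eD] /=.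
  by rewrite ffunE mresE; congr (Posz (m _)).
by have := fintype.forallP mD (val e); rewrite (negbTE eD) implybF negbK => /eqP ->.
Qed.

End RestrictionComplex.

(** * Biduality, and cells seen through the lineality space *)

Lemma bidual_eval (K : fieldType) (V : vectType K)
    (f : 'Hom('Hom(V, K^o), K^o)) : exists v, forall phi, f phi = phi v.
Proof.
pose b := vbasis (fullv : {vspace V}).
have bE x : x = \sum_i coord b i x *: b`_i by apply: coord_vbasis; rewrite memvf.
have dP i : exists d : 'Hom(V, K^o), forall x, d x = coord b i x.
  have lin : linear (coord b i : V -> K^o) by move=> a x y; rewrite linearP.
  pose c : {linear V -> K^o} :=
    HB.pack (coord b i : V -> K^o) (GRing.isLinear.Build _ _ _ _ _ lin).
  by exists (linfun c) => x; rewrite lfunE.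
pose d i := sval (cid (dP i)).
have dE i x : d i x = coord b i x by rewrite /d; case: cid.
(* The values of [f] on the dual basis are the coordinates of the representing vector. *)
exists (\sum_(i < \dim (fullv : {vspace V})) f (d i) *: b`_i) => phi.
have phiE : phi = \sum_(i < \dim (fullv : {vspace V})) phi b`_i *: d i.
  apply/lfunP => x; rewrite [x in LHS]bE linear_sum sum_lfunE.
  apply: eq_bigr => i _; rewrite linearZ scale_lfunE dE /=.
  exact: mulrC.
rewrite [phi in LHS]phiE [LHS](linear_sum f) [RHS](linear_sum phi).
apply: eq_bigr => i _; rewrite [LHS]linearZ [RHS]linearZ.
exact: mulrC.
Qed.

Section Cells.
Variables (R : realType) (E : finType).
Local Notation S := (polyring R[i] E).
Implicit Types (D G : {set E}) (m : {cmonom E}) (p : S) (v w u : E -> R).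

Lemma mdeg_sum m : mdeg m = (\sum_e m e)%N.
Proof.
rewrite mdegE big_uniq ?fset_uniq //= big_mkcond /=.
by apply: eq_bigr => e _; case: mdomP.
Qed.

(** The difference of the two sides is the sum of the nonnegative terms [(u e - c) * m e]; it
    vanishes exactly when [u e = c] for every variable occurring in [m]. *)
Lemma weight_min D G u c m : msupp_in G m ->
  (forall e, e \in G -> c <= u e /\ (u e == c) = (e \in D)) ->
  c * (mdeg m)%:R <= weight u m /\
  (weight u m == c * (mdeg m)%:R) = msupp_in D m.
Proof.
move=> /fintype.forallP mG uc.
have F0 e : 0 <= (u e - c) * (m e)%:R.
  have [->|me] := eqVneq (m e) 0%N; first by rewrite mulr0.
  have [cu _] := uc e (implyP (mG e) me).
  by rewrite mulr_ge0 // ?subr_ge0 // ler0n.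
have E1 : weight u m - c * (mdeg m)%:R = \sum_e (u e - c) * (m e)%:R.
  rewrite mdeg_sum natr_sum mulr_sumr -sumrB.
  by apply: eq_bigr => e _; rewrite mulrBl.
split; first by rewrite -subr_ge0 E1 sumr_ge0.
rewrite -subr_eq0 E1 psumr_eq0 //; apply/allP/fintype.forallP => h e.
  apply/implyP => me; have [_ <-] := uc e (implyP (mG e) me).
  have := h e (mem_index_enum _); rewrite /= mulf_eq0 pnatr_eq0.
  by rewrite (negbTE me) orbF subr_eq0.
move=> _ /=; have [->|me] := eqVneq (m e) 0%N; first by rewrite mulr0.
have [_ ue] := uc e (implyP (mG e) me).
move: (implyP (h e) me); rewrite -ue => /eqP ->.
by rewrite subrr mul0r.
Qed.

Lemma weightD v w m :
  weight (fun e => v e + w e) m = weight v m + weight w m.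
Proof.
by rewrite /weight -big_split; apply: eq_bigr => e _; rewrite mulrDl.
Qed.

Lemma eq_rho G p q : (forall m, msupp_in G m -> p@_m = q@_m) ->
  rho G p = rho G q.
Proof.
move=> pq; rewrite (rhoEw _ (fsubsetUl (msupp p) (msupp q))).
rewrite (rhoEw _ (fsubsetUr (msupp p) (msupp q))); apply: eq_bigr => m _.
exact/eq_monalgU_if/pq.
Qed.

Variable I : set S.
Hypothesis HI : is_ideal I.

(* [v] is the functional defining the cell, seen in the lineality space by
   biduality. *)
Lemma cellP w D : is_cell (configuration I) w D ->
  exists2 v, whomogeneous v I &
    exists c, forall e, c <= v e + w e /\ (v e + w e == c) = (e \in D).
Proof.
move=> [f ->]; have [v fv] := bidual_eval f.
have fE e : f (configuration I e) = vsval v e by rewrite fv configurationE.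
exists (vsval v).
  by apply/(init_ideal_fixP _ HI)/(lineality_spaceP HI); apply: subvsP.
(* With no labels there is no minimum to take, and any constant will do. *)
have [e0|E0] := pickP E; last by exists 0 => e; have := E0 e.
pose e1 := [arg min_(e < e0) (vsval v e + w e : R)]%O.
have e1P e : vsval v e1 + w e1 <= vsval v e + w e.
  by rewrite /e1; case: arg_minP => // i _; apply.
exists (vsval v e1 + w e1) => e; split=> //.
rewrite inE; apply/eqP/fintype.forallP => [h e'|h].
  by rewrite !fE h.
by apply/eqP; rewrite eq_le e1P andbT; have := h e1; rewrite !fE.
Qed.

(* With [u] the difference of the vectors of the two cells, the part of [p] of
   degree [d] on the variables of [D] is, among the monomials supported on [G],
   the part of lowest [u]-weight; it lies in [I] as [I] is [u]-homogeneous. *)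
Lemma rho_face w D G p : homogeneous_ideal I -> D \subset G ->
  is_cell (configuration I) w D -> is_cell (configuration I) w G -> I p ->
  ideal_gen (@toLaurent R[i] (vars G) @` (rho G @` I))
    (toLaurent (rho G (mrestr (msupp_in D) p))).
Proof.
move=> homI DG /cellP[v hv [c vc]] /cellP[v' hv' [c' vc']].
set J := ideal_gen _; have [J0 JD JM] : is_ideal J := ideal_gen_ideal _.
pose u e := -1 * v' e + v e.
have hu : whomogeneous u I := whomogeneous_lin (-1) HI hv' hv.
have uc e : e \in G -> c - c' <= u e /\ (u e == c - c') = (e \in D).
  have [_ <-] := vc' e; have [cv <-] := vc e; move=> /eqP <-.
  have -> : u e = v e + w e - (v' e + w e).
    by rewrite /u mulN1r opprD addrACA subrr addr0 addrC.
  by rewrite lerD2r (inj_eq (addIr _)).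
pose Q q := J (toLaurent (rho G (mrestr (msupp_in D) q))).
suff IQ : I `<=` Q by move=> /IQ.
apply: (ideal_split_ind HI).
- by rewrite /Q mrestr0 (raddf0 (@rho _ _ _)) (raddf0 (@toLaurent _ _)).
- move=> q r Qq Qr; rewrite /Q mrestrD (raddfD (@rho R[i] E G)).
  rewrite (raddfD (@toLaurent R[i] (vars G))); apply: JD.
    exact: Qq.
  exact: Qr.
(* [init_formE] supplies a monomial [m0] of the nonzero [q]; the component of its degree is split
   off. *)
move=> q Iq /(init_formE w)[m0 m0q _].
exists (fun m => mdeg m == mdeg m0); split; first by exists m0.
  exact: homI.
(* By [weight_min], among the monomials on [G] of this degree, those of this [u]-weight are exactly
   the ones supported on [D]. *)
have Iq' := hu _ (homI q Iq (mdeg m0)) ((c - c') * (mdeg m0)%:R).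
apply: sub_ideal_gen; eexists; last by [].
eexists; first exact: Iq'.
apply: eq_rho => m mG; rewrite !mcoeff_mrestr.
case: (eqVneq (mdeg m) (mdeg m0)) => [<-|_]; last by rewrite !if_same.
by have [_ ->] := weight_min mG uc.
Qed.

(* On a component of [p] of given degree and [v]-weight, the [D]-part is zero or
   the [w]-initial form. *)
Lemma mrestr_cell_init w D p : homogeneous_ideal I ->
  is_cell (configuration I) w D -> I p ->
  init_ideal w I (mrestr (msupp_in D) p).
Proof.
move=> homI /cellP[v hv [c vc]].
have [J0 JD JM] : is_ideal (init_ideal w I) := ideal_gen_ideal _.
pose Q q := init_ideal w I (mrestr (msupp_in D) q).
suff IQ : I `<=` Q by move=> /IQ.
apply: (ideal_split_ind HI).
- by rewrite /Q mrestr0.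
- by move=> q r Qq Qr; rewrite /Q mrestrD; apply: JD.
move=> q Iq /(init_formE w)[m0 m0q _].
(* Once degree and [v]-weight are fixed, the bound on the weight for [v + w] becomes a bound on the
   [w]-weight alone. *)
pose P m := (mdeg m == mdeg m0) && (weight v m == weight v m0).
have IP : I (mrestr P q).
  have := hv _ (homI q Iq (mdeg m0)) (weight v m0).
  rewrite /wcomp mrestr_comp; congr I; congr mrestr.
  by apply/funext => m; rewrite andbC.
exists P; split => //; first by exists m0; rewrite // /P !eqxx.
have [r0|] := eqVneq (mrestr (msupp_in D) (mrestr P q)) 0.
  by rewrite /Q r0.
(* The monomial [m1], being supported on [D], attains the lower bound, so the terms of minimal
   [w]-weight are exactly those on [D]. *)
move=> /(init_formE w)[m1 + _]; rewrite msupp_mrestr => /andP[m1D m1q].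
have wm m : m \in msupp (mrestr P q) ->
    c * (mdeg m0)%:R - weight v m0 <= weight w m /\
    (weight w m == c * (mdeg m0)%:R - weight v m0) = msupp_in D m.
  rewrite msupp_mrestr => /andP[/andP[/eqP <- /eqP <-] _].
  have mT : msupp_in [set: E] m.
    by apply/fintype.forallP => e; rewrite inE implybT.
  have [] := weight_min mT (fun e _ => vc e).
  rewrite weightD lerBlDl => ? <-; split=> //.
  by rewrite [LHS]eq_sym subr_eq [LHS]eq_sym addrC.
apply: sub_ideal_gen; exists (mrestr P q) => //.
apply/malgP => m; rewrite [LHS]mcoeff_mrestr [RHS]mcoeff_mrestr.
case: (msuppP (mrestr P q) m) => [mq|_]; last by rewrite !if_same.
congr (if _ then _ else _); have [m_ge mD] := wm m mq.
apply/allP/idP => [h|]; last first.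
  by rewrite -mD => /eqP -> m' m'q; have [] := wm m' m'q.
rewrite -mD eq_le m_ge andbT; have [_] := wm m1 m1q.
by rewrite m1D => /eqP <-; apply: h.
Qed.

End Cells.

(** * Connectedness of the set of covered labels *)

Section Connectivity.
Variables (R : realType) (E : finType).

(** For suitable [b] and [d] these are the cells met at time [s] along a line of functionals. *)
Definition aff_min (b d : E -> R) (s : R) : {set E} :=
  [set e | [forall e', b e + s * d e <= b e' + s * d e']].

(** A label that is not minimizing at [s0] is beaten there by a positive gap, which persists nearby;
    finitely many labels allow a common radius. *)
Lemma aff_min_near b d s0 : exists2 eps, 0 < eps &
  forall s, `|s - s0| < eps -> aff_min b d s \subset aff_min b d s0.
Proof.
have ex e : exists2 eps, 0 < eps &
    forall s, `|s - s0| < eps -> e \in aff_min b d s -> e \in aff_min b d s0.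
  have [_|] := boolP (e \in aff_min b d s0); first by exists 1.
  rewrite inE => /forallPn[e']; rewrite -ltNge => lt.
  pose gap := b e + s0 * d e - (b e' + s0 * d e').
  (* [k] bounds the rate at which the gap changes; the added 1 makes division by it safe when the
     slopes agree. *)
  pose k := `|d e' - d e| + 1.
  have k0 : 0 < k by rewrite ltr_wpDl.
  exists (gap / k) => [|s]; first by rewrite divr_gt0 // subr_gt0.
  rewrite ltr_pdivlMr // => lt_s; rewrite inE => /fintype.forallP/(_ e') le.
  have : gap <= (s - s0) * (d e' - d e).
    rewrite -subr_ge0 /gap; apply: le_trans (_ : 0 <= _) => //.
    move: le; rewrite -subr_ge0 => /le_trans -> //.
    by rewrite le_eqVlt; apply/orP; left; apply/eqP; ring.
  move=> /le_trans /(_ (ler_norm _)); rewrite normrM => h.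
  suff : gap < gap by rewrite ltxx.
  apply: le_lt_trans h (le_lt_trans _ lt_s).
  by rewrite ler_wpM2l // /k lerDl.
pose eps e := sval (cid2 (ex e)).
have epsP e : 0 < eps e /\
    forall s, `|s - s0| < eps e -> e \in aff_min b d s -> e \in aff_min b d s0.
  by rewrite /eps; case: cid2.
(* The default 1 keeps the radius positive even without labels. *)
exists (\big[Order.min/1]_e eps e).
  by apply: lt_bigmin => // e _; have [] := epsP e.
move=> s lts; apply/fintype.subsetP => e; apply: (epsP e).2.
by apply: lt_le_trans lts _; apply: bigmin_le.
Qed.

(* Minimizers can only shrink when moving slightly away from a point, so the
   supremum of the points of [0, 1] whose minimizers lie in [C] is 1. *)
Lemma aff_min_connected b d (C : {set E}) :
  (forall s e e', e \in aff_min b d s -> e' \in aff_min b d s ->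
    e \in C -> e' \in C) ->
  aff_min b d 0 \subset C -> aff_min b d 1 \subset C.
Proof.
move=> closedC C0.
have [e0 _|E0] := pickP E; last by apply/fintype.subsetP => e; have := E0 e.
have ne s : exists e, e \in aff_min b d s.
  exists [arg min_(e < e0) (b e + s * d e)]%O.
  by rewrite inE; apply/fintype.forallP => e'; case: arg_minP => // e _; apply.
pose T := [set s : R | 0 <= s <= 1 /\ aff_min b d s \subset C].
have T0 : T 0 by split=> //; rewrite lexx ler01.
have ubT : ubound T 1 by move=> s [/andP[]].
have hT : has_sup T by split; [exists 0|exists 1].
have s0 : 0 <= sup T by apply: sup_upper_bound.
have s1 : sup T <= 1 by apply: ge_sup => //; exists 0.
have [eps eps0 near] := aff_min_near b d (sup T).
(* The supremum lies in [T]: the minimizers at a nearby [t] in [T] are also minimizers at [sup T],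
   so one label there is in [C], and [closedC] spreads this to all of them. *)
have sC : aff_min b d (sup T) \subset C.
  have [t [t01 tC] lt_t] := sup_adherent eps0 hT.
  have [e et] := ne t.
  have le_t : t <= sup T by apply: (sup_upper_bound hT).
  have /fintype.subsetP/(_ e et) es : aff_min b d t \subset aff_min b d (sup T).
    by apply: near; rewrite distrC ger0_norm ?subr_ge0 // ltrBlDl -ltrBlDr.
  by apply/fintype.subsetP => e' e's; apply: closedC es e's (fintype.subsetP tC e et).
move: s1; rewrite le_eqVlt => /predU1P[<- //|s1].
(* A point past the supremum, within [eps] of it and capped at 1, is shown to lie in [T], a
   contradiction. *)
pose s := Num.min 1 (sup T + eps / 2).
have lt_s : sup T < s by rewrite lt_min s1 ltrDl divr_gt0.
suff : T s by move=> /(sup_upper_bound hT); rewrite leNgt lt_s.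
split; first by rewrite (le_trans s0 (ltW lt_s)) ge_min lexx.
apply: fintype.subset_trans sC; apply: near.
rewrite gtr0_norm ?subr_gt0 // ltrBlDl gt_min; apply/orP; right.
by rewrite ltrD2l gtr_pMr // invf_lt1 // ltr1n.
Qed.

(** The segment [f + s *: (g - f)] leads from [D] at 0 to [G] at 1, and the minimizers at each of
    its points form a cell. *)
Lemma cells_connected (V : vectType R) (a : E -> V) (w : E -> R) (C : {set E}) :
  (forall D e e', is_cell a w D -> e \in D -> e' \in D -> e \in C -> e' \in C) ->
  forall D G e e', is_cell a w D -> is_cell a w G ->
    e \in D -> e' \in G -> e \in C -> e' \in C.
Proof.
move=> closedC D G e e' cD [g ->]; have [f fD] := cD => eD e'G eC.
pose b i : R := f (a i) + w i; pose d i : R := (g - f) (a i).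
have cell_min s : aff_min b d s = minimizers a w (f + s *: (g - f)).
  apply/setP => i; rewrite !inE; apply: eq_forallb => j.
  by rewrite !add_lfunE !scale_lfunE /b /d ![_ + _ + w _]addrAC.
have cellC s i j : i \in aff_min b d s -> j \in aff_min b d s ->
    i \in C -> j \in C.
  by rewrite !cell_min; apply: closedC; exists (f + s *: (g - f)).
have C0 : aff_min b d 0 \subset C.
  rewrite cell_min scale0r addr0 -fD; apply/fintype.subsetP => i iD.
  exact: closedC cD eD iD eC.
have /fintype.subsetP := aff_min_connected cellC C0.
by rewrite cell_min scale1r addrC subrK; apply.
Qed.

End Connectivity.

(** * Generation of the degree-0 Laurent polynomials by ratios of variables *)

Section Generation.
Variables (K : comNzRingType) (E : finType) (A : set (laurent K E)).
Hypothesis AD : forall p q, A p -> A q -> A (p + q).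
Hypothesis AM : forall p q, A p -> A q -> A (p * q).
Hypothesis AC : forall c : K, A << c *g 0 >>.

(** The exponent of the variable [x_e]; a difference of two such exponents encodes a ratio of
    variables. *)
Definition unit_exp (F : finType) (e : F) : {ffun F -> int} :=
  [ffun e' => (e == e')%:R].

Lemma laurent_expD (a b : {ffun E -> int}) :
  A << a >> -> A << b >> -> A << a + b >>.
Proof. by move=> Aa Ab; have := AM Aa Ab; rewrite [_ * _]lmulUU mulr1. Qed.

Lemma homog0_generated :
  (forall e e', A << unit_exp e - unit_exp e' >>) ->
  forall p, homog0 p -> A p.
Proof.
move=> Aee p hp.
have A0 : A 0 by have := AC 0; rewrite monalgU0.
have Aexp (a : {ffun E -> int}) : \sum_e a e = 0 -> A << a >>.
  move=> a0; have [e0 _|E0] := pickP E; last first.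
    suff -> : a = 0 by exact: (AC 1).
    by apply/ffunP => e; have := E0 e.
  (* The base label [e0] is arbitrary: its total contribution is the sum of the [a e], which is
     zero. *)
  have -> : a = \sum_e (unit_exp e - unit_exp e0) *~ a e.
    apply/ffunP => e'; rewrite sum_ffunE.
    under eq_bigr do rewrite ffunMzE !ffunE mulrzBl.
    rewrite sumrB -mulrz_sumr a0 mulr0z subr0 (bigD1 e') //= eqxx intz.
    rewrite big1 ?addr0 // => e /negbTE ->; exact: mul0rz.
  apply: (big_ind (fun a : {ffun E -> int} => A << a >>)) => [||e _]; [exact: AC|exact: laurent_expD|].
  have AMn i j n : A << (unit_exp i - unit_exp j) *+ n >>.
    elim: n => [|n IH]; first exact: AC.
    by rewrite mulrS; apply: laurent_expD.
  case: (intP (a e)) => [|n|n]; first by rewrite mulr0z; apply: AC.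
    exact: AMn.
  (* A negative coefficient is absorbed by exchanging the two labels of the ratio. *)
  rewrite mulrNz -mulNrz opprB; exact: AMn.
rewrite [p]laurentE big_seq; apply: (big_ind A) => // a ap.
have -> : << p@_a *g a >> =
    (<< p@_a *g 0 >> : laurent K E) * (<< a >> : laurent K E).
  by rewrite [RHS]lmulUU mulr1 add0r.
by apply: AM (AC _) (Aexp _ (hp _ ap)).
Qed.

End Generation.

(** * Inclusions between the Laurent rings of cells *)

Section Inclusions.
Variables (K : comNzRingType) (E : finType).
Implicit Types D G H : {set E}.

Lemma val_insub (T : Type) (P : pred T) (U : subType P) x (u : U) :
  insub x = Some u -> val u = x.
Proof. by case: insubP => // v _ <- [->]. Qed.

Lemma incl_homog0 D (p : laurent K (vars D)) : homog0 p -> homog0 (incl p).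
Proof.
apply: (@laurent_map_homog0 _ _ _ _ (val : vars D -> E)) => [|e' e].
  exact: valK.
exact: val_insub.
Qed.

Lemma incl_cell_homog0 D G (p : laurent K (vars D)) : D \subset G ->
  homog0 p -> homog0 (@incl_cell K E D G p).
Proof.
move=> /fintype.subsetP DG.
pose h (e : vars D) : vars G := Sub (val e) (DG _ (valP e)).
apply: (@laurent_map_homog0 _ _ _ _ h) => [e|e' e] /=.
  by rewrite valK.
by move=> ge; apply: val_inj => /=; have := val_insub ge.
Qed.

Lemma incl_cell_id D (p : laurent K (vars D)) : incl_cell D p = p.
Proof.
rewrite -[RHS]laurent_map_id /incl_cell; congr laurent_map.
by apply/funext => e; rewrite valK.
Qed.

Lemma incl_cell_comp D G H (p : laurent K (vars D)) : D \subset G ->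
  incl_cell H (incl_cell G p) = incl_cell H p.
Proof.
move=> /fintype.subsetP DG; rewrite [LHS]laurent_map_comp; congr laurent_map.
apply/funext => e; case: insubP => //= [e' _ -> //|eG].
by rewrite insubF //; apply: contraNF eG; apply: DG.
Qed.

Lemma incl_incl_cell D G (p : laurent K (vars D)) : D \subset G ->
  incl (incl_cell G p) = incl p.
Proof.
move=> /fintype.subsetP DG; rewrite [LHS]laurent_map_comp; congr laurent_map.
apply/funext => e; case: insubP => //= [e' _ -> //|eG].
by rewrite insubF //; apply: contraNF eG; apply: DG.
Qed.

Lemma homog0U (F : finType) (c : K) (a : {ffun F -> int}) :
  \sum_e a e = 0 -> homog0 (<< c *g a >> : laurent K F).
Proof. by move=> a0 b /(fsubsetP msuppU_le); rewrite in_fset1 => /eqP ->. Qed.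

Lemma sum_unit_exp (F : finType) (e : F) : \sum_e' unit_exp e e' = 1 :> int.
Proof.
rewrite (bigD1 e) //= ffunE eqxx big1 ?addr0 // => e'.
by rewrite ffunE eq_sym => /negbTE ->.
Qed.

Lemma sum_unit_expB (F : finType) (e e' : F) :
  \sum_i (unit_exp e - unit_exp e') i = 0 :> int.
Proof.
rewrite (eq_bigr (fun i => unit_exp e i - unit_exp e' i)) => [|i _].
  by rewrite sumrB !sum_unit_exp subrr.
by rewrite !ffunE.
Qed.

Lemma incl_unit_exp D (e e' : vars D) :
  incl (<< unit_exp e - unit_exp e' >> : laurent K (vars D)) =
    << unit_exp (val e) - unit_exp (val e') >>.
Proof.
rewrite [LHS]laurent_mapU; congr mkmalgU; apply/ffunP => i.
rewrite !ffunE; case: insubP => [j _ <-|iD] /=; first by rewrite !ffunE.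
have ne (k : vars D) : (val k == i) = false.
  by apply: contraNF iD => /eqP <-; apply: valP.
by rewrite !ne.
Qed.

End Inclusions.

(** * The diagram, its cone and the mediating morphism *)

Theorem theorem6p2 (R : realType) (E : finType) (I : set (polyring R[i] E))
    (w : E -> R) :
  is_ideal I -> homogeneous_ideal I -> no_monomial I ->
  no_monomial (init_ideal w I) ->
  let X (D : cell I w) : affineScheme := cell_scheme I (sval D) in
  exists t : forall D G : cell I w, cell_le D G -> (X G ~> X D),
  [/\ forall D G (h : cell_le D G),
        induced_by (@incl_cell R[i] E (sval D) (sval G)) (t D G h),
      is_diagram t,
      exists (L : affineScheme) (q : forall D, L ~> X D), is_limit t q
    & exists p : forall D : cell I w, init_scheme I w ~> X D,
      [/\ forall D, induced_by (@incl R[i] E (sval D)) (p D),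
          is_cone t p
        & forall (L : affineScheme) (q : forall D, L ~> X D), is_limit t q ->
          exists u : init_scheme I w ~> L,
          [/\ is_mediating q p u,
              forall u' : init_scheme I w ~> L, is_mediating q p u' -> u' =1 u
            & (forall e : E, exists D : cell I w, e \in sval D) ->
              closed_immersion u]]].
Proof.
move=> HI homI _ _ X.
have exT (D G : cell I w) : cell_le D G -> exists phi : X G ~> X D,
    induced_by (@incl_cell R[i] E (sval D) (sval G)) phi.
  move=> DG; apply: induced_exists => [_ [_ [p Ip <-] <-]|p].
    rewrite [X in ideal_gen _ X](incl_cell_toLaurent_rho _ DG).
    by have := rho_face HI homI DG (svalP D) (svalP G) Ip.
  exact: incl_cell_homog0 DG.
have exP (D : cell I w) : exists phi : init_scheme I w ~> X D,
    induced_by (@incl R[i] E (sval D)) phi.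
  apply: induced_exists => [_ [_ [p Ip <-] <-]|p]; last exact: incl_homog0.
  rewrite [X in ideal_gen _ X]incl_toLaurent_rho; apply: sub_ideal_gen.
  eexists; last by [].
  by have := mrestr_cell_init HI homI (svalP D) Ip.
pose t D G h := sval (cid (exT D G h)).
have tE D G h : induced_by (@incl_cell R[i] E (sval D) (sval G)) (t D G h).
  by rewrite /t; case: cid.
pose p D := sval (cid (exP D)).
have pE D : induced_by (@incl R[i] E (sval D)) (p D) by rewrite /p; case: cid.
have pt : is_cone t p.
  (* Evaluating on a Laurent representative reduces identities between comorphisms to identities
     between the inclusions. *)
  move=> D G h z /=; apply: val_inj; have [r _ zr] := deg0P z.
  rewrite (pE _ _ _ (tE _ _ h _ _ zr)) (pE _ _ _ zr); congr qproj.
  exact: incl_incl_cell.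
exists t; split => //.
- split=> [D h z|D G H DG GH DH z]; apply: val_inj; have [r _ zr] := deg0P z.
    by rewrite (tE _ _ h _ _ zr) incl_cell_id zr.
  rewrite (tE _ _ DH _ _ zr) /= (tE _ _ GH _ _ (tE _ _ DG _ _ zr)).
  by congr qproj; rewrite incl_cell_comp.
- exact: affine_limit_exists.
exists p; split=> // L q [_ univ].
have [u up uniq] := univ _ _ pt; exists u; split=> // cover.
apply: closed_immersion_surj => b.
pose X' := @toLaurent R[i] E @` init_ideal w I.
(* [A] collects the Laurent polynomials whose class is in the image of [u]; surjectivity means that
   it contains all those of degree 0. *)
pose A r := exists l, val (u l : deg0 X') = qproj X' r.
have Aincl (D : cell I w) r : homog0 r -> A (@incl R[i] E (sval D) r).
  move=> hr.
  have hz : deg0_pred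
      (qproj (@toLaurent R[i] (vars (sval D)) @` (rho (sval D) @` I)) r).
    by apply/asboolP; exists r.
  pose z : coordRing (X D) := Sub _ hz.
  by exists (q D z); rewrite [u _]up; apply: pE.
have AD r s : A r -> A s -> A (r + s).
  move=> [l lr] [k ks]; exists (l + k).
  by rewrite rmorphD deg0_valD lr ks qprojD.
have AM r s : A r -> A s -> A (r * s).
  move=> [l lr] [k ks]; exists (l * k).
  by rewrite rmorphM deg0_valM lr ks qprojM.
have AC (c : R[i]) : A << c *g 0 >>.
  (* Constants lie in the ring of any cell; the zero functional provides one. *)
  pose D : cell I w :=
    exist _ (minimizers (configuration I) w 0) (ex_intro _ 0 erefl).
  have /(Aincl D) : homog0 (<< c *g 0 >> : laurent R[i] (vars (sval D))).
    by apply: homog0U; rewrite big1 // => e _; rewrite ffunE.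
  by rewrite [incl _]laurent_mapU exp_map0.
have Aee e e' : A << unit_exp e - unit_exp e' >>.
  (* The labels [i] with [x_e / x_i] in the image: for [i] and [j] in a common cell, multiplying by
     [x_i / x_j] passes from [i] to [j]. *)
  pose C : {set E} := [set i | `[< A << unit_exp e - unit_exp i >> >]]%SET.
  have eC : e \in C by rewrite inE subrr; apply/asboolP/AC.
  have [D eD] := cover e; have [G e'G] := cover e'.
  suff : e' \in C by rewrite inE => /asboolP.
  apply: (cells_connected _ (svalP D) (svalP G) eD e'G eC).
  move=> H i j cH iH jH; rewrite !inE => Ai.
  pose a : {ffun vars H -> int} := unit_exp (Sub i iH) - unit_exp (Sub j jH).
  have /(Aincl (exist _ H cH)) : homog0 (<< a >> : laurent R[i] (vars H)).
    by apply/homog0U/sum_unit_expB.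
  rewrite incl_unit_exp /= => /(laurent_expD AM Ai).
  by rewrite addrA subrK.
have [r hr br] := deg0P (b : deg0 X').
have [l lr] := homog0_generated AD AM AC Aee hr.
by exists l; apply: val_inj; rewrite lr br.
Qed.
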